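(* Let $n\ge 2$, let $B$ be a horoball in hyperbolic space $\mathbb{H}^n$, let $\Omega\subset B$ be an unbounded open set, and let $\lambda\in[0,\lambda_1]$, where $\lambda_1=\frac{(n-1)^2}{4}$. Then there is no bounded eigenfunction associated to $\lambda$ in $\Omega$.
   Context: $\Delta$ is the Laplace–Beltrami operator of $\mathbb{H}^n$ (curvature $-1$), and $\lambda_1=\lambda_1(\mathbb{H}^n)=\frac{(n-1)^2}{4}$. For an open set $\Omega\subset\mathbb{H}^n$ and $\lambda\in\mathbb{R}$, an eigenfunction associated to $\lambda$ in $\Omega$ is a function $u\in C(\overline{\Omega})\cap C^2(\Omega)$, not identically zero, with $-\Delta u=\lambda u$ in $\Omega$ and $u=0$ on $\partial\Omega$ (closure and boundary taken in $\mathbb{H}^n$). No boundedness or decay at infinity is part of the definition. *)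

(* Defs.v *)
From HB Require Import structures.
From mathcomp Require Import all_boot all_order all_algebra.
From mathcomp Require Import all_classical all_reals all_analysis.

Set Implicit Arguments.
Unset Strict Implicit.
Unset Printing Implicit Defensive.

Import Order.TTheory GRing.Theory Num.Theory.
Import numFieldNormedType.Exports.

Local Open Scope classical_set_scope.
Local Open Scope ring_scope.

(** Calculus in the coordinates of R^n. *)

Definition partial (R : realType) (n : nat) (i : 'I_n) (f : 'rV[R]_n -> R) :
  'rV[R]_n -> R := fun x => 'D_(delta_mx 0 i) f x.

Definition C0_on (R : realType) (n : nat) (A : set 'rV[R]_n)
  (f : 'rV[R]_n -> R) : Prop := forall x, A x -> {for x, continuous f}.

Definition C1_on (R : realType) (n : nat) (A : set 'rV[R]_n)
  (f : 'rV[R]_n -> R) : Prop :=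
  [/\ C0_on A f,
      forall i x, A x -> derivable f x (delta_mx 0 i)
    & forall i, C0_on A (partial i f)].

(* Meant for open [A]: only then do these conditions depend on nothing but the
   restriction of [f] to [A]. *)
Definition C2_on (R : realType) (n : nat) (A : set 'rV[R]_n)
  (f : 'rV[R]_n -> R) : Prop :=
  C1_on A f /\ forall i, C1_on A (partial i f).

(* For a Riemannian metric with coordinate matrix [g]:
   |g|^(-1/2) \sum_i d_i (|g|^(1/2) \sum_j g^{ij} d_j u). *)
Definition laplace_beltrami (R : realType) (n : nat)
  (g : 'rV[R]_n -> 'M[R]_n) (u : 'rV[R]_n -> R) (x : 'rV[R]_n) : R :=
  (Num.sqrt (\det (g x)))^-1 *
  \sum_(i < n) partial i
    (fun z => Num.sqrt (\det (g z)) *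
              \sum_(j < n) invmx (g z) i j * partial j u z) x.

(** The upper half-space model of hyperbolic space of dimension n.+1: the
    points of R^(n.+1) with positive last coordinate x_n, with the metric
    |dx|^2 / x_n^2, of constant curvature -1. *)

Definition height (R : realType) (n : nat) (x : 'rV[R]_n.+1) : R :=
  x ord0 ord_max.

Definition hspace (R : realType) (n : nat) : set 'rV[R]_n.+1 :=
  [set x | 0 < height x].

Definition hmetric (R : realType) (n : nat) (x : 'rV[R]_n.+1) : 'M[R]_n.+1 :=
  ((height x ^+ 2)^-1)%:M.

Definition hlaplacian (R : realType) (n : nat) (u : 'rV[R]_n.+1 -> R) :
  'rV[R]_n.+1 -> R := laplace_beltrami (@hmetric R n) u.

Definition arcosh (R : realType) (t : R) : R := ln (t + Num.sqrt (t ^+ 2 - 1)).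

(* The Riemannian distance of the half-space model,
   cosh d(x, y) = 1 + |x - y|^2 / (2 x_n y_n), with |.| the Euclidean norm (the
   library norm on row vectors is the sup norm). *)
Definition hdist (R : realType) (n : nat) (x y : 'rV[R]_n.+1) : R :=
  arcosh (1 + (\sum_(i < n.+1) (x ord0 i - y ord0 i) ^+ 2)
              / (2 * height x * height y)).

Definition hbounded (R : realType) (n : nat) (A : set 'rV[R]_n.+1) : Prop :=
  exists r : R, forall x y, A x -> A y -> hdist x y <= r.

Definition geodesic_ray (R : realType) (n : nat) (c : R -> 'rV[R]_n.+1) : Prop :=
  (forall t, 0 <= t -> hspace (c t)) /\
  (forall s t, 0 <= s -> 0 <= t -> hdist (c s) (c t) = `|s - t|).

(* The open horoball {b_c < 0}, where b_c (x) = lim_(t -> +oo) (d(x, c t) - t)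
   is the Busemann function of the ray [c]. Moving the origin of [c] along its
   geodesic line gives all the levels {b_c < s}. *)
Definition horoball_of (R : realType) (n : nat) (c : R -> 'rV[R]_n.+1) :
  set 'rV[R]_n.+1 :=
  [set x | hspace x /\
    exists2 b : R, hdist x (c t) - t @[t --> +oo] --> b & b < 0].

Definition horoball (R : realType) (n : nat) (B : set 'rV[R]_n.+1) : Prop :=
  exists2 c : R -> 'rV[R]_n.+1, geodesic_ray c & B = horoball_of c.

(* The topology of hyperbolic space is induced by that of R^(n.+1); closures
   and boundaries are relative to the half-space. *)
Definition hclosure (R : realType) (n : nat) (A : set 'rV[R]_n.+1) :
  set 'rV[R]_n.+1 := @hspace R n `&` closure A.

Definition hboundary (R : realType) (n : nat) (A : set 'rV[R]_n.+1) :
  set 'rV[R]_n.+1 := hclosure A `\` interior A.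

(* [u] is a total function, but only its values on [hclosure Omega] matter when
   [Omega] is open. *)
Definition eigenfunction (R : realType) (n : nat) (lambda : R)
  (Omega : set 'rV[R]_n.+1) (u : 'rV[R]_n.+1 -> R) : Prop :=
  [/\ {within hclosure Omega, continuous u} /\ C2_on Omega u,
      exists2 x, hclosure Omega x & u x != 0,
      forall x, Omega x -> - hlaplacian u x = lambda * u x
    & forall x, hboundary Omega x -> u x = 0].

(* Bottom of the spectrum in dimension [d]. *)
Definition lambda1 (R : realType) (d : nat) : R := (d%:R - 1) ^+ 2 / 4.

(* Main.v *)
Require Import Defs.
From HB Require Import structures.
From mathcomp Require Import all_boot all_order all_algebra.
From mathcomp Require Import all_classical all_reals all_analysis.
From mathcomp Require Import ring lra.

Import Order.TTheory GRing.Theory Num.Theory.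
Import numFieldNormedType.Exports.

Local Open Scope classical_set_scope.
Local Open Scope ring_scope.

Set Implicit Arguments.
Unset Strict Implicit.
Unset Printing Implicit Defensive.

(** A maximum principle of Phragmen-Lindelof type, with explicit barriers. Let
    N = n+1 be the dimension, y the height, s = n/2, so that lambda1 = s^2, and
    let rho(x) = |x - xi|^2 for a point xi of the ideal boundary y = 0. The
    half-space Laplacian multiplies y^a rho^b by
    a (a - n) + 4 b (a + b) y^2 / rho  ([hlaplacian_monomial]).

    A horoball is contained in some {p >= c} with c > 0, where p = y when the
    ray converges to infinity and p = y / rho when it converges to xi
    ([horoball_escaping_ray], [horoball_bounded_ray]). Put tau = rho in the
    first case (with xi = 0) and tau = 1 / rho in the second, which is what the
    inversion about xi turns (y, rho) into. Then, in both cases, Delta + lambda1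
    kills p^s, maps p^(s-1) to p^(s-1), and maps p^s tau to 4 (s+1) p^(s+2).
    Hence w = 2 p^s - c p^(s-1), which lies between p^s and 2 p^s on {p >= c},
    satisfies Delta w = - lambda1 w - c p^(s-1): it is a strict supersolution
    for lambda1, and a fortiori for every lambda <= lambda1.

    Let u be a bounded eigenfunction, positive at some x0. The barrier w tends
    to infinity with p, so u / w is small where p is large; but w does not tend
    to infinity along the horospheres. There the term eps p^s tau takes over:
    maximize (u - eps p^s tau) / w. The maximum k is attained at some z, in a
    compact set where p <= Y and tau <= T, with Y independent of eps, and it
    stays above a fixed k0 > 0. Near z, u <= k w + eps p^s tau with equality
    at z, so comparing Laplacians gives k c p^(s-1) <= 4 eps (s+1) p^(s+2) at z,
    hence k0 c <= 4 eps (s+1) Y^3, which is false for eps small. So u <= 0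
    ([bounded_subsolution_le0]), and the same applied to -u gives u = 0. *)

(** * Directional derivatives *)

Lemma is_derive_gt0_right (R : realType) (g : R -> R) (d : R) :
  is_derive (0 : R) 1 g d -> g 0 = 0 -> 0 < d ->
  exists2 r : R, 0 < r & forall t, 0 < t -> t < r -> 0 < g t.
Proof.
move=> [cg vg] g0 d0.
have : h^-1 *: ((g \o shift 0) (h *: 1) - g 0) @[h --> (0:R)^'] --> d.
  by rewrite -vg; exact: cg.
move/(_ _ (open_nbhs_nbhs (conj (@open_gt _ 0) d0))).
clear cg vg.
move=> /nbhs_ballP[r /= r0 hr]; exists r => // t t0 tr.
have : 0 < t^-1 * (g (t * 1 + 0) - g 0).
  by apply: (hr t); rewrite ?gt_eqF // /ball /= sub0r normrN gtr0_norm.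
by rewrite mulr1 addr0 g0 subr0 pmulr_rgt0 // invr_gt0.
Qed.

Section directional_derivatives.
Context (R : realType) (V : normedModType R).
Implicit Types (f : V -> R) (x v : V).

(** Reduces directional derivatives to one-variable calculus: the difference
    quotients on both sides are the same function. *)
Lemma is_derive_line f x v (t df : R) :
  is_derive t 1 (fun s => f (x + s *: v)) df <-> is_derive (x + t *: v) v f df.
Proof.
have E : (fun h : R => h^-1 *: (((fun s => f (x + s *: v)) \o shift t) (h *: 1)
    - f (x + t *: v)))
  = (fun h : R => h^-1 *: ((f \o shift (x + t *: v)) (h *: v) - f (x + t *: v))).
  apply/funext => h /=; congr (_ *: (f _ - _)).
  by rewrite -[h *: 1]/(h * 1) mulr1 scalerDl addrCA.
by split=> -[d1 d2]; split; move: d1 d2; rewrite /derivable /derive E.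
Qed.

Lemma is_derive_comp_dir (g : R -> R) f x v (df dg : R) :
  is_derive x v f df -> is_derive (f x) 1 g dg ->
  is_derive x v (fun y => g (f y)) (dg * df).
Proof.
move=> hf hg.
suff : is_derive (0 : R) 1 (fun s => g (f (x + s *: v))) (dg * df).
  by move/(is_derive_line (fun y => g (f y))); rewrite scale0r addr0.
have {}hf : is_derive (0 : R) 1 (fun s => f (x + s *: v)) df.
  by apply/is_derive_line; rewrite scale0r addr0.
have {}hg : is_derive (f (x + 0 *: v)) 1 g dg by rewrite scale0r addr0.
exact: (@is_derive1_comp _ g (fun s => f (x + s *: v)) 0 dg df hg hf).
Qed.

(** Were the second derivative at the maximum positive, the first one, which
    vanishes there, would be positive just after it, and the mean value theorem
    would make [f] increase along the line. *)
Lemma second_derivative_test f z v :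
  (\forall x \near z, derivable f x v) -> derivable ('D_v f) z v ->
  (\forall x \near z, f x <= f z) ->
  'D_v f z = 0 /\ 'D_v ('D_v f) z <= 0.
Proof.
move=> hd hdd hmax.
have cvg_line : (fun s : R => z + s *: v) @ (0 : R) --> z.
  rewrite -[X in _ --> X]addr0 -[X in _ + X](scale0r v).
  by apply: cvgD; [exact: cvg_cst | apply: cvgZr_tmp; exact: cvg_id].
have : \forall s \near (0 : R),
    derivable f (z + s *: v) v /\ f (z + s *: v) <= f z.
  exact: (cvg_line _ (filterI hd hmax)).
move=> /nbhs_ballP[e /= e0 he].
have {}he (t : R) : `|t| < e ->
    derivable f (z + t *: v) v /\ f (z + t *: v) <= f z.
  by move=> te; apply: (he t); rewrite /ball /= sub0r normrN.
pose phi (s : R) : R := f (z + s *: v).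
pose psi (s : R) : R := 'D_v f (z + s *: v).
have dphi (t : R) : `|t| < e -> is_derive t 1 phi (psi t).
  by move=> /he[/derivableP h _]; apply/is_derive_line.
have d0 : is_derive (0:R) 1 phi 0.
  apply: (@derive1_at_max R phi (- e) e 0).
  - by rewrite (@le_trans _ _ 0) ?oppr_le0 ?ltW.
  - by move=> t; rewrite in_itv /= -ltr_norml => /dphi[].
  - by rewrite in_itv /= oppr_lt0 e0.
  - move=> t; rewrite in_itv /= -ltr_norml => /he[_].
    by rewrite /phi scale0r addr0.
have D0 : 'D_v f z = 0.
  move/is_derive_line: d0; rewrite scale0r addr0 => d0.
  by rewrite (@derive_val _ _ _ _ _ _ _ d0).
split=> //; rewrite leNgt; apply/negP => Dpos.
have hpsi : is_derive (0 : R) 1 psi ('D_v ('D_v f) z).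
  apply/(is_derive_line ('D_v f)); rewrite scale0r addr0.
  exact/derivableP.
have psi0 : psi 0 = 0 by rewrite /psi scale0r addr0.
have [r r0 hr] := is_derive_gt0_right hpsi psi0 Dpos.
clear hpsi d0.
pose m := Num.min (e / 2) (r / 2).
have m0 : 0 < m by rewrite lt_min !divr_gt0.
have me : m < e by rewrite gt_min; apply/orP; left; rewrite ltr_pdivrMr //; lra.
have mr : m < r.
  by rewrite gt_min; apply/orP; right; rewrite ltr_pdivrMr //; lra.
have psi_gt0 (t : R) : 0 < t -> t <= m -> 0 < psi t.
  by move=> t0 tm; apply: hr => //; exact: le_lt_trans tm mr.
have nt (t : R) : 0 <= t -> t <= m -> `|t| < e.
  by move=> t0 tm; rewrite ger0_norm // (le_lt_trans tm).
have [||c] := @MVT R phi psi 0 m m0.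
- move=> t; rewrite in_itv /= => /andP[t0 tm].
  by apply: dphi; apply: nt; exact: ltW.
- apply: derivable_within_continuous => t; rewrite in_itv /= => /andP[t0 tm].
  by case: (dphi t (nt _ t0 tm)).
rewrite in_itv /= => /andP[c0 cm]; rewrite subr0 => E.
have : phi m <= phi 0.
  by rewrite {2}/phi scale0r addr0; apply: (he m _).2; rewrite gtr0_norm.
rewrite leNgt -subr_gt0 E mulr_gt0 //.
by apply: psi_gt0 => //; exact: ltW.
Qed.

End directional_derivatives.

(** * The Laplacian of the half-space *)

Section hyperbolic_laplacian.
Context (R : realType) (n : nat).
Notation E := 'rV[R]_n.+1.
Implicit Types (u w : E -> R) (x z xi : E) (A : set E) (i j : 'I_n.+1).

(** The part of [C2_on] that computing a Laplacian requires: only pure second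
    derivatives occur in it, because the metric is diagonal. *)
Definition twice_partial A u : Prop :=
  forall i x, A x ->
    derivable u x (delta_mx 0 i) /\ derivable (partial i u) x (delta_mx 0 i).

Lemma C2_on_twice_partial A u : C2_on A u -> twice_partial A u.
Proof.
move=> [[_ h1 _] h2] i x Ax; split; first exact: h1.
by case: (h2 i) => _ h _; exact: h.
Qed.

Lemma is_derive_coord x (v : E) j :
  is_derive x v (fun y : E => y 0 j) (v 0 j).
Proof.
have hid : derivable (@id E) x v by exact: derivable_id.
have hj := (derivable_mxP _ _ _).1 hid 0 j.
split; first exact: hj.
have := derive_mx hid; rewrite derive_id => {2}->.
by rewrite mxE.
Qed.

Lemma is_derive_height x i :
  is_derive x (delta_mx 0 i) (@height R n) (i == ord_max)%:R.
Proof.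
apply: is_derive_eq; first exact: (is_derive_coord x _ ord_max).
by rewrite mxE eqxx eq_sym.
Qed.

Lemma is_derive_height_powR x i (a : R) : 0 < height x ->
  is_derive x (delta_mx 0 i) (fun z => height z `^ a)
    (a * height x `^ (a - 1) * (i == ord_max)%:R).
Proof.
move=> y0; apply: (is_derive_comp_dir (g := @powR R ^~ a) (f := @height R n)).
  exact: is_derive_height.
exact: is_derive1_powR.
Qed.

Lemma sqrt_det_hmetric x : 0 < height x ->
  Num.sqrt (\det (hmetric x)) = (height x ^+ n.+1)^-1.
Proof.
move=> y0; rewrite /hmetric det_scalar exprVn -exprM mulnC exprM -exprVn.
by rewrite sqrtr_sqr ger0_norm // invr_ge0 exprn_ge0 // ltW.
Qed.

(** The metric is conformal with factor 1 / y^2 in dimension n+1, so the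
    volume density y^-(n+1) times the inverse metric y^2 is y^(1-n). *)
Lemma hmetric_flux u i x : 0 < height x ->
  Num.sqrt (\det (hmetric x)) *
    (\sum_(j < n.+1) invmx (hmetric x) i j * partial j u x)
  = height x `^ (1 - n%:R) * partial i u x.
Proof.
move=> y0; rewrite sqrt_det_hmetric // /hmetric invmx_scalar invrK.
rewrite (bigD1 i) //= big1 ?addr0 => [|j ji]; last first.
  by rewrite mxE eq_sym (negbTE ji) mulr0n mul0r.
rewrite mxE eqxx mulr1n mulrA; congr (_ * _).
rewrite powRB ?lt0r_neq0 ?implybT // powRr1 ?ltW // powR_mulrn ?ltW //.
have yn0 := lt0r_neq0 y0.
by rewrite exprS; field; rewrite yn0 expf_neq0.
Qed.

Lemma hlaplacianE A u x : open A -> A `<=` @hspace R n -> twice_partial A u ->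
  A x -> hlaplacian u x =
    height x ^+ 2 * (\sum_(i < n.+1) partial i (partial i u) x)
    - (n%:R - 1) * height x * partial ord_max u x.
Proof.
move=> oA AH hu Ax.
have y0 : 0 < height x by exact: AH.
have yn0 := lt0r_neq0 y0.
rewrite /hlaplacian /laplace_beltrami sqrt_det_hmetric // invrK.
have D i : partial i (fun z => Num.sqrt (\det (hmetric z)) *
      (\sum_(j < n.+1) invmx (hmetric z) i j * partial j u z)) x =
    height x `^ (1 - n%:R) * partial i (partial i u) x +
    (1 - n%:R) * height x `^ (- n%:R) * (i == ord_max)%:R * partial i u x.
  rewrite /partial (@near_eq_derive _ _ _ _
    (fun z => height z `^ (1 - n%:R) * partial i u z)); last first.
    have := open_nbhs_nbhs (conj oA Ax).
    by apply: filterS => z /AH /(hmetric_flux u i).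
  have d1 := is_derive_height_powR i (1 - n%:R) y0.
  have /derivableP d2 := (hu i x Ax).2.
  rewrite (@derive_val _ _ _ _ _ _ _ (is_deriveM d1 d2)).
  rewrite /GRing.scale /=.
  rewrite [1 - _ - 1]addrAC subrr add0r.
  by rewrite [X in _ + X = _]mulrC.
rewrite (eq_bigr _ (fun i _ => D i)) big_split /= -mulr_sumr.
rewrite [X in _ + X](bigD1 ord_max) //= [X in _ + (_ + X)]big1; last first.
  by move=> i /negbTE ->; rewrite mulr0 mul0r.
rewrite eqxx mulr1 addr0 mulrDr.
rewrite powRB ?yn0 ?implybT // powRN powRr1 ?ltW // powR_mulrn ?ltW //.
by rewrite exprS; field; rewrite expf_neq0.
Qed.

End hyperbolic_laplacian.

Section laplacian_theory.
Context (R : realType) (n : nat).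
Notation E := 'rV[R]_n.+1.
Implicit Types (u w : E -> R) (x z : E) (A : set E) (i : 'I_n.+1).

Lemma is_derive_lin u w x (v : E) (a du dw : R) :
  is_derive x v u du -> is_derive x v w dw ->
  is_derive x v (fun z => a * u z + w z) (a * du + dw).
Proof. by move=> hu hw; exact: (is_deriveD (is_deriveZ a hu) hw). Qed.

Lemma partial_lin A u w (a : R) i x : twice_partial A u -> twice_partial A w ->
  A x ->
  partial i (fun z => a * u z + w z) x = a * partial i u x + partial i w x.
Proof.
move=> hu hw Ax.
have [/derivableP du _] := hu i x Ax; have [/derivableP dw _] := hw i x Ax.
exact: (@derive_val _ _ _ _ _ _ _ (is_derive_lin a du dw)).
Qed.

Lemma is_derive_partial_lin A u w (a : R) i x : open A ->
  twice_partial A u -> twice_partial A w -> A x ->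
  is_derive x (delta_mx 0 i) (partial i (fun z => a * u z + w z))
    (a * partial i (partial i u) x + partial i (partial i w) x).
Proof.
move=> oA hu hw Ax.
apply: (@near_eq_is_derive _ _ _ (fun z => a * partial i u z + partial i w z)).
  apply: filterS (open_nbhs_nbhs (conj oA Ax)) => z Az.
  by rewrite (partial_lin a i hu hw Az).
have [_ /derivableP du] := hu i x Ax; have [_ /derivableP dw] := hw i x Ax.
exact: is_derive_lin.
Qed.

Lemma twice_partial_lin A u w (a : R) : open A ->
  twice_partial A u -> twice_partial A w ->
  twice_partial A (fun z => a * u z + w z).
Proof.
move=> oA hu hw i x Ax; split; last first.
  by case: (is_derive_partial_lin a i oA hu hw Ax).
have [/derivableP du _] := hu i x Ax; have [/derivableP dw _] := hw i x Ax.
by case: (is_derive_lin a du dw).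
Qed.

Lemma hlaplacian_lin A u w (a : R) x : open A -> A `<=` @hspace R n ->
  twice_partial A u -> twice_partial A w -> A x ->
  hlaplacian (fun z => a * u z + w z) x = a * hlaplacian u x + hlaplacian w x.
Proof.
move=> oA AH hu hw Ax.
have alg (y k U W pu pw : R) :
    y ^+ 2 * (a * U + W) - (k - 1) * y * (a * pu + pw)
    = a * (y ^+ 2 * U - (k - 1) * y * pu) + (y ^+ 2 * W - (k - 1) * y * pw).
  by ring.
have D i : partial i (partial i (fun z => a * u z + w z)) x =
    a * partial i (partial i u) x + partial i (partial i w) x.
  by case: (is_derive_partial_lin a i oA hu hw Ax).
rewrite (hlaplacianE oA AH (twice_partial_lin a oA hu hw) Ax).
rewrite (partial_lin a ord_max hu hw Ax).
rewrite (eq_bigr _ (fun i _ => D i)) big_split /= -mulr_sumr.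
rewrite (hlaplacianE oA AH hu Ax) (hlaplacianE oA AH hw Ax).
exact: alg.
Qed.

(** At a maximum, the first-order term of [hlaplacianE] vanishes and every pure
    second derivative is nonpositive. *)
Lemma hlaplacian_le0_at_max A u z : open A -> A `<=` @hspace R n ->
  twice_partial A u -> A z -> (forall x, A x -> u x <= u z) ->
  hlaplacian u z <= 0.
Proof.
move=> oA AH hu Az umax.
have nA := open_nbhs_nbhs (conj oA Az).
have D i : partial i u z = 0 /\ partial i (partial i u) z <= 0.
  apply: second_derivative_test.
  - by apply: filterS nA => x /(hu i)[].
  - by case: (hu i z Az).
  - by apply: filterS nA => x /umax.
rewrite (hlaplacianE oA AH hu Az) (D ord_max).1 mulr0 subr0.
rewrite mulr_ge0_le0 ?sqr_ge0 //.
by rewrite -oppr_ge0 -sumrN sumr_ge0 // => i _; rewrite oppr_ge0 (D i).2.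
Qed.

End laplacian_theory.

(** * Products of powers of the height and of a distance *)

Section monomials.
Context (R : realType) (n : nat).
Notation E := 'rV[R]_n.+1.
Implicit Types (x z xi : E) (i j : 'I_n.+1).

Definition sqdist xi x : R := \sum_(i < n.+1) (x 0 i - xi 0 i) ^+ 2.

Definition monomial xi (a b : R) x : R := height x `^ a * sqdist xi x `^ b.

Lemma is_derive_coordB x i j (t : R) :
  is_derive x (delta_mx 0 i) (fun y : E => y 0 j - t) (j == i)%:R.
Proof.
apply: is_derive_eq (is_deriveB (is_derive_coord x (delta_mx 0 i) j)
  (is_derive_cst t x (delta_mx 0 i))) _.
by rewrite mxE eqxx subr0.
Qed.

Lemma is_derive_sqdist xi x i :
  is_derive x (delta_mx 0 i) (sqdist xi) (2 * (x 0 i - xi 0 i)).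
Proof.
have -> : sqdist xi = \sum_(j < n.+1) (fun x : E => (x 0 j - xi 0 j) ^+ 2).
  by apply/funext => y; rewrite fct_sumE.
have d j : is_derive x (delta_mx 0 i) (fun x : E => (x 0 j - xi 0 j) ^+ 2)
    (2 * (x 0 j - xi 0 j) * (j == i)%:R).
  by apply: (is_derive_eq (is_deriveX 2 (is_derive_coordB x i j (xi 0 j)))).
apply: is_derive_eq (is_derive_sum d) _.
rewrite (bigD1 i) //= big1 ?addr0 ?eqxx ?mulr1 // => j /negbTE ->.
by rewrite mulr0.
Qed.

Lemma sqr_height_le_sqdist xi x : height xi = 0 -> height x ^+ 2 <= sqdist xi x.
Proof.
move=> xi0; rewrite /sqdist (bigD1 ord_max) //= {1}/height.
have -> : xi 0 ord_max = 0 by [].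
by rewrite subr0 lerDl sumr_ge0 // => j _; exact: sqr_ge0.
Qed.

Lemma sqdist_gt0 xi x : height xi = 0 -> hspace x -> 0 < sqdist xi x.
Proof.
move=> xi0 y0; apply: lt_le_trans (sqr_height_le_sqdist x xi0).
exact: exprn_gt0.
Qed.

Lemma is_derive_monomial xi (a b : R) x i : height xi = 0 -> hspace x ->
  is_derive x (delta_mx 0 i) (monomial xi a b)
    (a * (i == ord_max)%:R * monomial xi (a - 1) b x +
     2 * b * ((x 0 i - xi 0 i) * monomial xi a (b - 1) x)).
Proof.
move=> xi0 y0.
have r0 := sqdist_gt0 xi0 y0.
have d1 := is_derive_height_powR i a y0.
have d2 := is_derive_comp_dir (is_derive_sqdist xi x i) (is_derive1_powR b r0).
apply: (is_derive_eq (is_deriveM d1 d2)).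
by rewrite /monomial /GRing.scale /=; ring.
Qed.

Lemma open_hspace : open (@hspace R n).
Proof.
apply: (open_comp (f := fun x : E => x 0 ord_max) (D := [set r | 0 < r])).
  by move=> x _; exact: coord_continuous.
exact: open_gt.
Qed.

Lemma is_derive_partial_monomial xi (a b : R) x i : height xi = 0 -> hspace x ->
  is_derive x (delta_mx 0 i) (partial i (monomial xi a b))
    (a * (i == ord_max)%:R *
       ((a - 1) * (i == ord_max)%:R * monomial xi (a - 1 - 1) b x +
        2 * b * ((x 0 i - xi 0 i) * monomial xi (a - 1) (b - 1) x)) +
     2 * b * (monomial xi a (b - 1) x + (x 0 i - xi 0 i) *
       (a * (i == ord_max)%:R * monomial xi (a - 1) (b - 1) x +
        2 * (b - 1) * ((x 0 i - xi 0 i) * monomial xi a (b - 1 - 1) x)))).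
Proof.
move=> xi0 y0.
apply: (@near_eq_is_derive _ _ _ (fun z =>
    a * (i == ord_max)%:R * monomial xi (a - 1) b z +
    2 * b * ((z 0 i - xi 0 i) * monomial xi a (b - 1) z))).
  apply: filterS (open_nbhs_nbhs (conj open_hspace y0)) => z z0.
  by case: (is_derive_monomial a b i xi0 z0) => _ <-.
have d1 := is_derive_monomial (a - 1) b i xi0 y0.
have d2 := is_derive_monomial a (b - 1) i xi0 y0.
have d3 := is_derive_coordB x i i (xi 0 i).
rewrite eqxx in d3.
apply: (is_derive_eq (is_deriveD (is_deriveZ (a * (i == ord_max)%:R) d1)
  (is_deriveZ (2 * b) (is_deriveM d3 d2)))).
by rewrite /GRing.scale /=; ring.
Qed.

Lemma twice_partial_monomial xi (a b : R) : height xi = 0 ->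
  twice_partial (@hspace R n) (monomial xi a b).
Proof.
move=> xi0 i x y0; split.
  by case: (is_derive_monomial a b i xi0 y0).
by case: (is_derive_partial_monomial a b i xi0 y0).
Qed.

(** The mixed term of the Laplacian involves only y-derivatives, where
    d rho / dy = 2 y because [xi] has height 0; so everything is expressed by
    a, b, n and the ratio y^2 / rho. *)
Lemma hlaplacian_monomial xi (a b : R) x : height xi = 0 -> hspace x ->
  hlaplacian (monomial xi a b) x =
    (a * (a - n%:R) + 4 * b * (a + b) * (height x ^+ 2 / sqdist xi x))
      * monomial xi a b x.
Proof.
move=> xi0 y0.
have r0 := sqdist_gt0 xi0 y0.
have yn0 : height x != 0 by exact: lt0r_neq0.
have rn0 := lt0r_neq0 r0.
rewrite (hlaplacianE open_hspace (@subset_refl _ _)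
  (twice_partial_monomial a b xi0) y0).
have -> : partial ord_max (monomial xi a b) x =
    a * monomial xi (a - 1) b x + 2 * b * (height x * monomial xi a (b - 1) x).
  case: (is_derive_monomial a b ord_max xi0 y0) => _; rewrite /partial => ->.
  have -> : xi 0 ord_max = 0 by [].
  by rewrite eqxx mulr1 subr0.
have D i : partial i (partial i (monomial xi a b)) x =
    (i == ord_max)%:R * (a * (a - 1) * monomial xi (a - 1 - 1) b x
       + 4 * a * b * height x * monomial xi (a - 1) (b - 1) x)
    + 2 * b * monomial xi a (b - 1) x
    + (x 0 i - xi 0 i) ^+ 2 * (4 * b * (b - 1) * monomial xi a (b - 1 - 1) x).
  apply: etrans (@derive_val _ _ _ _ _ _ _
    (is_derive_partial_monomial a b i xi0 y0)) _.
  have [->|_] /= := eqVneq i ord_max; last first.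
    by ring.
  have -> : xi 0 ord_max = 0 by [].
  by rewrite subr0 -/(height x); ring.
(* Summing [D]: the first term picks the height direction, the second one counts
   n+1 directions, and the third one rebuilds the squared distance. *)
rewrite (eq_bigr _ (fun i _ => D i)) !big_split /= -!mulr_suml.
rewrite (bigD1 ord_max) //= big1 ?eqxx => [|i /negbTE ->]; last by [].
rewrite sumr_const card_ord -/(sqdist xi x) mulrS -[_ *+ n]mulr_natr.
rewrite /monomial.
have Y c : height x `^ (c - 1) = height x `^ c / height x.
  by rewrite powRB ?yn0 ?implybT // powRr1 // ltW.
have Q c : sqdist xi x `^ (c - 1) = sqdist xi x `^ c / sqdist xi x.
  by rewrite powRB ?rn0 ?implybT // powRr1 // ltW.
rewrite !Y !Q -[true%:R]/(1 : R); field.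
by rewrite yn0 rn0.
Qed.

End monomials.

(** * Horoballs in terms of the height and of the distance to an ideal point *)

Section horoballs.
Context (R : realType) (n : nat).
Notation E := 'rV[R]_n.+1.
Implicit Types (x z p xi : E) (B : set E) (c : R -> E).

Lemma sqdistC x z : sqdist x z = sqdist z x.
Proof. by apply: eq_bigr => i _; rewrite -opprB sqrrN. Qed.

Lemma sqdist_ge0 x z : 0 <= sqdist x z.
Proof. by apply: sumr_ge0 => i _; exact: sqr_ge0. Qed.

Lemma continuous_sqdist xi : continuous (sqdist xi).
Proof.
have -> : sqdist xi = (fun x : E => \sum_(i < n.+1) (x 0 i - xi 0 i) ^+ 2) by [].
apply: continuous_big => [|i _].
  exact: add_continuous.
move=> x; apply: (@continuous_comp _ _ _ (fun x : E => x 0 i - xi 0 i)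
  (fun r : R => r ^+ 2)).
  exact: (cvgB (@coord_continuous R 1 n.+1 0 i x) (cvg_cst (xi 0 i))).
exact: exprn_continuous.
Qed.

Lemma continuous_height : continuous (@height R n).
Proof. exact: coord_continuous. Qed.

Lemma closed_ge0 (g : E -> R) : continuous g -> closed [set p | 0 <= g p].
Proof.
move=> cg; apply: (@preimage_closed E R g [set r | 0 <= r]).
  by move=> x _; exact: cg.
exact: closed_ge.
Qed.

Lemma ler_arcosh : {in [pred t : R | 1 <= t] &, {homo @arcosh R : s t / s <= t}}.
Proof.
move=> s t; rewrite !inE => s1 t1 st.
have pos r : 1 <= r -> 0 < r + Num.sqrt (r ^+ 2 - 1) :> R.
  by move=> r1; rewrite ltr_pwDl ?sqrtr_ge0 // (lt_le_trans ltr01).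
rewrite /arcosh ler_ln ?posrE ?pos // lerD // ler_wsqrtr // lerD2r.
by rewrite lerXn2r ?nnegrE // (le_trans ler01).
Qed.

Lemma arcosh_le_double (t : R) : 1 <= t -> arcosh t <= 2 * t.
Proof.
move=> t1; have t0 : 0 < t by exact: lt_le_trans t1.
have st : Num.sqrt (t ^+ 2 - 1) <= t.
  apply: (@le_trans _ _ (Num.sqrt (t ^+ 2))); first by rewrite ler_wsqrtr ?gerBl.
  by rewrite sqrtr_sqr gtr0_norm.
have s0 := sqrtr_ge0 (t ^+ 2 - 1).
apply: le_trans (ltW (ln_sublinear _)) _; first by rewrite ltr_pwDl.
by rewrite mulr_natl mulr2n lerD2l.
Qed.

Lemma hdist_arg_ge1 x z : hspace x -> hspace z ->
  1 <= 1 + sqdist z x / (2 * height x * height z).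
Proof.
by move=> x0 z0; rewrite lerDl divr_ge0 ?sqdist_ge0 // !mulr_ge0 // ltW.
Qed.

(** Since arcosh r <= 2 r, the identity d(c 0, c t) = t forces
    |c 0 - c t|^2 / (y_0 y_t) >= t - 2; so a ray that stays in a Euclidean
    bounded region has heights tending to 0. *)
Lemma ray_tends_to_boundary c t : geodesic_ray c -> 0 <= t ->
  height (c t) * ((t - 2) * height (c 0)) <= sqdist (c 0) (c t).
Proof.
move=> [hc iso] t0.
have y0 := hc 0 (lexx 0); have yt := hc t t0.
have : t <= 2 * (1 + sqdist (c t) (c 0) / (2 * height (c 0) * height (c t))).
  have := iso 0 t (lexx 0) t0; rewrite sub0r normrN ger0_norm // => {1}<-.
  exact: arcosh_le_double (hdist_arg_ge1 y0 yt).
rewrite sqdistC.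
have -> : 2 * (1 + sqdist (c 0) (c t) / (2 * height (c 0) * height (c t)))
  = 2 + sqdist (c 0) (c t) / (height (c t) * height (c 0)).
  by field; rewrite !lt0r_neq0.
rewrite -lerBlDl ler_pdivlMr ?mulr_gt0 //.
by rewrite mulrCA.
Qed.

(** A point [z] of the horoball satisfies d(z, c t) < t = d(c 0, c t) for large
    [t]; as arcosh is monotone, this is a polynomial inequality between
    Euclidean distances, which passes to the limit along [c]. *)
Lemma horoball_eventually_closer c z : geodesic_ray c -> horoball_of c z ->
  \forall t \near +oo,
    height (c 0) * sqdist z (c t) <= height z * sqdist (c 0) (c t).
Proof.
move=> [hc iso] [z0 [b cvb b0]].
have ev : \forall t \near +oo, (hdist z (c t) - t < 0) /\ (0 <= t).
  apply: filterI; first exact: cvgr_lt cvb _ b0.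
  exact: nbhs_pinfty_ge (num_real 0).
apply: filterS ev => t [/=]; rewrite subr_lt0 => dlt t0.
have y0 := hc 0 (lexx 0); have yt := hc t t0.
rewrite leNgt; apply/negP => lt_zc; move: dlt; apply/negP; rewrite -leNgt.
have := iso 0 t (lexx 0) t0; rewrite sub0r normrN ger0_norm // => {1}<-.
apply: ler_arcosh; rewrite ?inE; [exact: hdist_arg_ge1..|].
rewrite lerD2l ler_pdivrMr ?mulr_gt0 // mulrAC ler_pdivlMr ?mulr_gt0 //.
rewrite -/(sqdist (c t) (c 0)) -/(sqdist (c t) z) !(sqdistC (c t)).
have -> : sqdist (c 0) (c t) * (2 * height z * height (c t)) =
  2 * height (c t) * (height z * sqdist (c 0) (c t)) by ring.
have -> : sqdist z (c t) * (2 * height (c 0) * height (c t)) =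
  2 * height (c t) * (height (c 0) * sqdist z (c t)) by ring.
by rewrite ler_wpM2l ?mulr_ge0 // ltW.
Qed.

End horoballs.

Section horoball_models.
Context (R : realType) (n : nat).
Notation E := 'rV[R]_n.+1.
Implicit Types (x z p xi : E) (B : set E) (c : R -> E).

Lemma bounded_sublevel_sqdist (M : R) : bounded_set [set x : E | sqdist 0 x <= M].
Proof.
exists (1 + M); split; first exact: num_real.
move=> N MN x /= hx.
rewrite [leLHS]/Num.Def.normr /= mx_normrE; apply: bigmax_le => [|[i j] _ /=].
  by apply: le_trans (ltW MN); rewrite addr_ge0 // (le_trans (sqdist_ge0 _ _) hx).
apply: le_trans (ltW MN); rewrite ord1.
have hj : `|x 0 j| ^+ 2 <= M.
  apply: le_trans hx; rewrite /sqdist (bigD1 j) //= mxE subr0.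
  rewrite real_normK ?num_real //.
  by rewrite lerDl sumr_ge0 // => k _; exact: sqr_ge0.
have := sqr_ge0 (`|x 0 j| - 1); have := normr_ge0 (x 0 j).
nra.
Qed.

(** The inequality y_0 |z - c t|^2 <= y |c 0 - c t|^2 has leading terms
    y_0 |c t|^2 and y |c t|^2, so y < y_0 would bound |c t|. *)
Lemma horoball_escaping_ray c : geodesic_ray c ->
  (forall M, ~ \forall t \near +oo, sqdist 0 (c t) <= M) ->
  forall z, horoball_of c z -> height (c 0) <= height z.
Proof.
move=> rc unb z Bz; rewrite leNgt; apply/negP => ltz.
pose y := height z; pose y0 := height (c 0); pose d := y0 - y.
have d0 : 0 < d by rewrite subr_gt0.
pose be i := y0 * z 0 i - y * c 0 0 i.
pose C i := 2 * (be i) ^+ 2 / d + y * c 0 0 i ^+ 2 - y0 * z 0 i ^+ 2.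
apply: (unb (2 * (\sum_i C i) / d)).
apply: filterS (horoball_eventually_closer rc Bz) => t le_t.
rewrite ler_pdivlMr // -subr_ge0.
have : 0 <= 2 * (y * sqdist (c 0) (c t) - y0 * sqdist z (c t)).
  by rewrite mulr_ge0 // subr_ge0.
move/le_trans; apply.
rewrite mulrC mulrBl /sqdist !mulr_sumr !mulr_suml -!sumrB.
apply: ler_sum => i _; rewrite mxE subr0 -subr_ge0.
(* [C i] is chosen to complete the square:
   d q^2 - 2 be q >= d q^2 / 2 - 2 be^2 / d. *)
set q := c t 0 i.
have -> : 2 * C i - q ^+ 2 * d
    - (y * (q - c 0 0 i) ^+ 2 * 2 - y0 * (q - z 0 i) ^+ 2 * 2)
  = (d * q - 2 * be i) ^+ 2 / d.
  have dn0 : y0 - y != 0 by exact: lt0r_neq0.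
  by rewrite /C /be /d; field.
by rewrite divr_ge0 ?sqr_ge0 // ltW.
Qed.

(** The center [xi] is a cluster point of the ray: every closed condition that
    holds for [c t] with [t] large holds at [xi]. The lower bound
    [ray_tends_to_boundary] puts [xi] at height 0. *)
Lemma horoball_bounded_ray c (M : R) : geodesic_ray c ->
  (\forall t \near +oo, sqdist 0 (c t) <= M) ->
  exists2 xi, height xi = 0 & forall z, horoball_of c z ->
    height (c 0) * sqdist xi z <= height z * sqdist xi (c 0).
Proof.
move=> rc hM.
have [hc _] := rc.
have [|xi [_ clxi]] := @bounded_closed_compact R n.+1 [set x | sqdist 0 x <= M]
    (bounded_sublevel_sqdist M) _ (c @ +oo) _ hM.
  have -> : [set x : E | sqdist 0 x <= M] = [set x | 0 <= M - sqdist 0 x].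
    by apply/seteqP; split => x /=; rewrite subr_ge0.
  apply: closed_ge0 => x.
  exact: (cvgB (cvg_cst M) (@continuous_sqdist R n 0 x)).
have at_xi (g : E -> R) : continuous g ->
    (\forall t \near +oo, 0 <= g (c t)) -> 0 <= g xi.
  move=> cg ev; apply: (closed_ge0 cg).
  by move: clxi; rewrite clusterE => /(_ [set p | 0 <= g p] ev).
have y0 := hc 0 (lexx 0).
exists xi.
  apply/eqP; rewrite eq_le; apply/andP; split; last first.
    apply: at_xi; first exact: continuous_height.
    by apply: filterS (nbhs_pinfty_ge (num_real 0)) => t /hc /ltW.
  have bound (T : R) : 0 <= sqdist (c 0) xi - height xi * (T * height (c 0)).
    apply: (at_xi (fun p => sqdist (c 0) p - height p * (T * height (c 0)))).
      move=> x; apply: (cvgB (@continuous_sqdist R n (c 0) x)).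
      exact: (cvgM (@continuous_height R n x) (cvg_cst _)).
    apply: filterS (nbhs_pinfty_ge (num_real (Num.max 0 (T + 2)))) => t.
    rewrite ge_max => /andP[t0 tT]; have yt := hc t t0.
    rewrite subr_ge0; apply: le_trans (ray_tends_to_boundary rc t0).
    by rewrite (ler_wpM2l (ltW yt)) // (ler_wpM2r (ltW y0)) // lerBrDr.
  rewrite leNgt; apply/negP => h0.
  have := bound ((sqdist (c 0) xi + 1) / (height xi * height (c 0))).
  have -> : sqdist (c 0) xi - height xi *
    ((sqdist (c 0) xi + 1) / (height xi * height (c 0)) * height (c 0)) = - 1.
    by field; rewrite !lt0r_neq0.
  by rewrite lerNr oppr0 ler10.
move=> z Bz; rewrite -subr_ge0 !(sqdistC xi).
apply: (at_xi (fun p => height z * sqdist (c 0) p - height (c 0) * sqdist z p)).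
  move=> x.
  exact: (cvgB (cvgM (cvg_cst (height z)) (@continuous_sqdist R n (c 0) x))
    (cvgM (cvg_cst (height (c 0))) (@continuous_sqdist R n z x))).
by apply: filterS (horoball_eventually_closer rc Bz) => t; rewrite subr_ge0.
Qed.

End horoball_models.

(** * Barriers on a horoball *)

Section barriers.
Context (R : realType) (n : nat).
Notation E := 'rV[R]_n.+1.
Implicit Types (x xi : E) (inv : bool) (a b e : R).

(** A positive function constant on the horospheres centered at infinity, or at
    [xi] if [inv] holds; the second one is the first one composed with the
    inversion about [xi]. *)
Definition horoheight inv xi x : R :=
  if inv then height x / sqdist xi x else height x.

(** The squared distance to [xi], composed with the same inversion if [inv]
    holds; on a horoball it tends to infinity at the center of the horoball. *)
Definition hororadius inv xi x : R :=
  if inv then (sqdist xi x)^-1 else sqdist xi x.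

(** [horoheight ^ e] and [horoheight ^ e * hororadius], written as monomials so
    that [hlaplacian_monomial] applies to them; see [height_powerE] and
    [growing_barrierE]. *)
Definition height_power inv xi e : E -> R := monomial xi e (- (inv%:R * e)).

Definition growing_barrier inv xi e : E -> R :=
  monomial xi e (1 - inv%:R * (e + 2)).

Lemma horoheight_gt0 inv xi x : height xi = 0 -> hspace x ->
  0 < horoheight inv xi x.
Proof.
by move=> xi0 y0; case: inv; rewrite // /horoheight divr_gt0 ?sqdist_gt0.
Qed.

Lemma hororadius_gt0 inv xi x : height xi = 0 -> hspace x ->
  0 < hororadius inv xi x.
Proof.
by move=> xi0 y0; case: inv; rewrite /hororadius ?invr_gt0 sqdist_gt0.
Qed.

Lemma height_powerE inv xi e x : height xi = 0 -> hspace x ->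
  height_power inv xi e x = horoheight inv xi x `^ e.
Proof.
move=> xi0 y0; have r0 := sqdist_gt0 xi0 y0.
case: inv; rewrite /height_power /monomial /horoheight.
  rewrite mul1r powRM ?invr_ge0 ?(ltW y0) ?(ltW r0) //.
  by rewrite -(powR_inv1 (ltW r0)) -powRrM mulN1r.
by rewrite mul0r oppr0 powRr0 mulr1.
Qed.

Lemma height_powerB1 inv xi e x : height xi = 0 -> hspace x ->
  height_power inv xi (e - 1) x = height_power inv xi e x / horoheight inv xi x.
Proof.
move=> xi0 y0; have p0 := horoheight_gt0 inv xi0 y0.
by rewrite !height_powerE // powRB ?lt0r_neq0 ?implybT // powRr1 // ltW.
Qed.

Lemma growing_barrierE inv xi e x : height xi = 0 -> hspace x ->
  growing_barrier inv xi e x = height_power inv xi e x * hororadius inv xi x.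
Proof.
move=> xi0 y0; have r0 := sqdist_gt0 xi0 y0.
have rn0 := lt0r_neq0 r0.
rewrite /growing_barrier /height_power /monomial -mulrA; congr (_ * _).
case: inv; rewrite /hororadius ?mul1r ?mul0r.
  have -> : 1 - (e + 2) = - e - 1 by ring.
  by rewrite powRB ?rn0 ?implybT // powRr1 // ltW.
by rewrite subr0 oppr0 powRr0 mul1r powRr1 // ltW.
Qed.

(** Here b = 0 or a + b = 0 in [hlaplacian_monomial]: its last term vanishes. *)
Lemma hlaplacian_height_power inv xi e x : height xi = 0 -> hspace x ->
  hlaplacian (height_power inv xi e) x =
    e * (e - n%:R) * height_power inv xi e x.
Proof.
move=> xi0 y0; rewrite hlaplacian_monomial // -/(height_power inv xi e).
by case: inv => /=; rewrite ?mul1r ?mul0r ?oppr0 ?subrr !(mulr0, mul0r) addr0.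
Qed.

(** Here (b, a + b) is (1, e + 1) or (- e - 1, - 1), so b (a + b) = e + 1 both
    times, and y^2 / rho * (p^e tau) = p^(e+2). *)
Lemma hlaplacian_growing_barrier inv xi e x : height xi = 0 -> hspace x ->
  hlaplacian (growing_barrier inv xi e) x =
    e * (e - n%:R) * growing_barrier inv xi e x
    + 4 * (e + 1) * (horoheight inv xi x ^+ 2 * height_power inv xi e x).
Proof.
move=> xi0 y0; have rn0 := lt0r_neq0 (sqdist_gt0 xi0 y0).
rewrite hlaplacian_monomial // -/(growing_barrier inv xi e).
rewrite !growing_barrierE //.
by case: inv; rewrite /horoheight /hororadius
  -?[true%:R]/(1 : R) -?[false%:R]/(0 : R); field.
Qed.

Lemma powR_continuous_at (r a : R) : 0 < r -> {for r, continuous (@powR R ^~ a)}.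
Proof.
move=> r0; apply/differentiable_continuous/derivable1_diffP.
by case: (is_derive1_powR a r0).
Qed.

Lemma continuous_monomial xi a b x : height xi = 0 -> hspace x ->
  {for x, continuous (monomial xi a b)}.
Proof.
move=> xi0 y0.
have c1 : {for x, continuous (fun z : E => height z `^ a)}.
  apply: (@continuous_comp _ _ _ (@height R n) (@powR R ^~ a)).
    exact: continuous_height.
  exact: powR_continuous_at.
have c2 : {for x, continuous (fun z : E => sqdist xi z `^ b)}.
  apply: (@continuous_comp _ _ _ (sqdist xi) (@powR R ^~ b)).
    exact: continuous_sqdist.
  exact/powR_continuous_at/sqdist_gt0.
exact: (continuousM c1 c2).
Qed.

Lemma sqdist0_le xi x : sqdist 0 x <= 2 * sqdist xi x + 2 * sqdist 0 xi.
Proof.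
rewrite /sqdist !mulr_sumr -big_split /=; apply: ler_sum => i _.
rewrite mxE !subr0 -subr_ge0.
have -> : 2 * (x 0 i - xi 0 i) ^+ 2 + 2 * xi 0 i ^+ 2 - x 0 i ^+ 2
  = (x 0 i - 2 * xi 0 i) ^+ 2 by ring.
exact: sqr_ge0.
Qed.

(** For a center [xi] at finite distance, y >= c rho together with
    y^2 <= rho bounds rho by 1 / c^2, and 1 / rho <= T bounds y from below. *)
Lemma horoball_cap_bounded inv xi (c T : R) : height xi = 0 -> 0 < c ->
  exists2 y0 : R, 0 < y0 & exists M, forall x, hspace x ->
    c <= horoheight inv xi x -> hororadius inv xi x <= T ->
    y0 <= height x /\ sqdist 0 x <= M.
Proof.
move=> xi0 c0; case: inv; rewrite /horoheight /hororadius.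
  (* [`|T| + 1] rather than [T]: the statement allows T <= 0. *)
  exists (c / (`|T| + 1)).
    by rewrite divr_gt0 // ltr_wpDl.
  exists (2 * (c ^- 2) + 2 * sqdist 0 xi) => x y0.
  have r0 := sqdist_gt0 xi0 y0.
  rewrite ler_pdivlMr // => le_cy le_rT; split.
    apply: le_trans le_cy; rewrite ler_pM2l // -[leRHS]invrK lef_pV2 ?posrE.
    - by apply: le_trans le_rT _; apply: le_trans (ler_norm T) _; rewrite lerDl.
    - by rewrite ltr_wpDl.
    - by rewrite invr_gt0.
  apply: le_trans (sqdist0_le xi x) _; rewrite lerD2r ler_pM2l //.
  rewrite -[leRHS]mul1r ler_pdivlMr ?exprn_gt0 //.
  have := sqr_height_le_sqdist x xi0.
  have : (c * sqdist xi x) ^+ 2 <= height x ^+ 2.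
    by rewrite lerXn2r // nnegrE ?mulr_ge0 // ltW.
  move=> /le_trans h /h; rewrite exprMn [_ ^+ 2 * _]mulrC expr2 -!mulrA.
  by rewrite -[leRHS]mulr1 ler_pM2l.
exists c => //; exists (2 * T + 2 * sqdist 0 xi) => x y0 le_cy le_rT.
by split=> //; apply: le_trans (sqdist0_le xi x) _; rewrite lerD2r ler_pM2l.
Qed.

End barriers.

(** * The maximum principle *)

Section phragmen_lindelof.
Context (R : realType) (n : nat).
Notation E := 'rV[R]_n.+1.
Implicit Types (x z xi : E) (inv : bool) (u : E -> R) (Omega : set E).

Lemma exists_small_pos (a A b B : R) : 0 < a -> 0 <= A -> 0 < b -> 0 <= B ->
  exists2 e : R, 0 < e & e * A < a /\ e * B < b.
Proof.
move=> a0 A0 b0 B0.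
have A1 : 0 < A + 1 by rewrite ltr_wpDl.
have B1 : 0 < B + 1 by rewrite ltr_wpDl.
pose e := Num.min (a / (A + 1)) (b / (B + 1)).
have e0 : 0 < e by rewrite lt_min !divr_gt0.
exists e => //; split.
  have : e * (A + 1) <= a by rewrite -ler_pdivlMr // ge_min lexx.
  by apply: lt_le_trans; rewrite ltr_pM2l // ltrDl.
have : e * (B + 1) <= b by rewrite -ler_pdivlMr // ge_min lexx orbT.
by apply: lt_le_trans; rewrite ltr_pM2l // ltrDl.
Qed.

Lemma compact_cap Omega (y0 M : R) :
  compact (closure Omega `&` [set x : E | 0 <= height x - y0]
            `&` [set x : E | 0 <= M - sqdist 0 x]).
Proof.
apply: bounded_closed_compact.
  have [N [Nreal hN]] := @bounded_sublevel_sqdist R n M.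
  exists N; split=> // K NK x [_ /=]; rewrite subr_ge0 => h.
  exact: (hN K NK).
apply: closedI; first apply: closedI; first exact: closed_closure.
  apply: closed_ge0 => x.
  exact: (cvgB (@continuous_height R n x) (cvg_cst y0)).
apply: closed_ge0 => x.
exact: (cvgB (cvg_cst M) (@continuous_sqdist R n 0 x)).
Qed.

(** The core of the argument: [k0] is fixed first, then [Y], which makes
    (u - eps g) / w < k0 where p > Y whatever [eps] is, then [eps], and finally
    [T], which makes it negative where tau > T. The strictness of the
    supersolution [w] is bounded below on p <= Y, which is what pays for the
    error of the growing barrier [g]. *)
Lemma bounded_subsolution_le0 inv xi (c lambda M : R) Omega u :
  (0 < n)%N -> height xi = 0 -> 0 < c -> lambda <= lambda1 R n.+1 ->
  open Omega -> Omega `<=` @hspace R n ->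
  (forall x, hclosure Omega x -> c <= horoheight inv xi x) ->
  {within hclosure Omega, continuous u} -> twice_partial Omega u ->
  (forall x, Omega x -> - hlaplacian u x = lambda * u x) ->
  (forall x, hboundary Omega x -> u x = 0) ->
  (forall x, hclosure Omega x -> u x <= M) ->
  forall x, hclosure Omega x -> u x <= 0.
Proof.
move=> n0 xi0 c0 hlam oO OH hc cu tu eigu bdu uM x0 Ox0.
rewrite leNgt; apply/negP => ux0.
have M0 : 0 < M by exact: lt_le_trans ux0 (uM x0 Ox0).
pose s : R := n%:R / 2.
have s0 : 0 < s by rewrite divr_gt0 // ltr0n.
pose p := horoheight inv xi; pose tau := hororadius inv xi.
pose f := height_power inv xi s.
pose f' := height_power inv xi (s - 1).
pose g := growing_barrier inv xi s.
pose w x := 2 * f x - c * f' x.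
have HO x : hclosure Omega x -> hspace x by case.
have p0 x : hspace x -> 0 < p x by exact: horoheight_gt0.
have tau0 x : hspace x -> 0 < tau x by exact: hororadius_gt0.
have fE x : hspace x -> f x = p x `^ s by exact: height_powerE.
have f0 x : hspace x -> 0 < f x by move=> Hx; rewrite fE // powR_gt0 // p0.
have f'E x : hspace x -> f' x = f x / p x by exact: height_powerB1.
have gE x : hspace x -> g x = f x * tau x by exact: growing_barrierE.
have g0 x : hspace x -> 0 < g x by move=> Hx; rewrite gE // mulr_gt0 ?f0 ?tau0.
have fw x : hclosure Omega x -> f x <= w x.
  move=> Ox; have Hx := HO x Ox.
  have : c * f' x <= f x.
    rewrite f'E // mulrCA ger_pMr ?f0 // ler_pdivrMr ?p0 // mul1r.
    exact: hc.
  rewrite /w; lra.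
have w0 x : hclosure Omega x -> 0 < w x.
  by move=> Ox; apply: lt_le_trans (fw x Ox); apply: f0; exact: HO.
pose k0 := u x0 / (2 * w x0).
have k00 : 0 < k0 by rewrite divr_gt0 // mulr_gt0 // w0.
pose Y := (M / k0 + 1) `^ s^-1.
have Y0 : 0 < Y by rewrite powR_gt0 // ltr_pwDr // divr_ge0 // ltW.
have [eps eps0 [eps_x0 eps_Y]] :
    exists2 e : R, 0 < e & e * g x0 < u x0 / 2 /\
      e * (4 * (s + 1) * Y ^+ 3) < k0 * c.
  apply: exists_small_pos.
  - by rewrite divr_gt0.
  - by apply/ltW/g0; exact: HO.
  - by rewrite mulr_gt0.
  - have s1 : 0 <= s + 1 by rewrite addr_ge0 // ltW.
    by rewrite (mulr_ge0 (mulr_ge0 (ler0n _ 4) s1)) // exprn_ge0 // ltW.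
pose T := M / (eps * c `^ s).
pose G x := (u x - eps * g x) / w x.
have Gx0 : k0 < G x0.
  rewrite /k0 /G ltr_pdivlMr ?w0 //.
  have -> : u x0 / (2 * w x0) * w x0 = u x0 / 2.
    by field; rewrite lt0r_neq0 // w0.
  lra.
have Gcap x : hclosure Omega x -> k0 < G x -> p x <= Y /\ tau x <= T.
  move=> Ox; have Hx := HO x Ox; rewrite /G ltr_pdivlMr ?w0 // => ltx.
  have kf : k0 * f x <= k0 * w x by rewrite ler_pM2l // fw.
  have kf0 : 0 < k0 * f x by rewrite mulr_gt0 // f0.
  have eg0 : 0 < eps * g x by rewrite mulr_gt0 // g0.
  have ux := uM x Ox.
  split; rewrite leNgt; apply/negP => gt_x.
    have : M / k0 + 1 <= f x.
      rewrite fE //; have <- : Y `^ s = M / k0 + 1.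
        rewrite /Y -powRrM mulVf ?lt0r_neq0 // powRr1 //.
        by rewrite addr_ge0 // divr_ge0 // ltW.
      by rewrite ge0_ler_powR ?nnegrE ?ltW // (lt_trans Y0).
    move=> h; have : k0 * (M / k0 + 1) <= k0 * f x by rewrite ler_pM2l.
    rewrite mulrDr mulrCA divff ?lt0r_neq0 //; lra.
  have : c `^ s <= f x.
    rewrite fE //; apply: (ge0_ler_powR (ltW s0)); last exact: hc.
      by rewrite nnegrE ltW.
    by rewrite nnegrE ltW // p0.
  move=> h; have c_s : 0 < c `^ s by exact: powR_gt0.
  have T0 : 0 < T by rewrite divr_gt0 // mulr_gt0.
  have h1 : eps * (c `^ s * T) = M.
    by rewrite /T; field; rewrite !lt0r_neq0.
  have h2 : eps * (c `^ s * T) <= eps * (f x * tau x).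
    by rewrite ler_pM2l // ler_pM // ltW.
  by move: ltx eg0; rewrite gE //; lra.
have [y0 y00 [M1 capb]] := horoball_cap_bounded inv T xi0 c0.
pose K : set E := closure Omega `&` [set x : E | 0 <= height x - y0]
            `&` [set x : E | 0 <= M1 - sqdist 0 x].
have KO : K `<=` hclosure Omega.
  move=> x [[clx]]; rewrite /= !subr_ge0 => hx _; split=> //.
  exact: lt_le_trans y00 hx.
have inK x : hclosure Omega x -> k0 < G x -> K x.
  move=> Ox /(Gcap x Ox)[_ tx].
  have [h1 h2] := capb x (HO x Ox) (hc x Ox) tx.
  by split; [split; [case: Ox | rewrite /= subr_ge0] | rewrite /= subr_ge0].
have cG (x : E) : K x -> G @ within K (nbhs x) --> G x.
  move=> Kx.
  have Hx := HO x (KO x Kx).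
  have cu' : u @ within K (nbhs x) --> u x.
    by move/subspace_continuousP: (continuous_subspaceW KO cu); exact.
  have FK : Filter (within K (nbhs x)) by exact: within_filter.
  have cf : f @ x --> f x by exact: continuous_monomial.
  have cf' : f' @ x --> f' x by exact: continuous_monomial.
  have cg : g @ x --> g x by exact: continuous_monomial.
  have wn0 : w x != 0 by apply/lt0r_neq0/w0/KO.
  have cw : w @ x --> w x.
    exact: (cvgB (cvgM (cvg_cst (2 : R)) cf) (cvgM (cvg_cst c) cf')).
  have ceg : (fun y => eps * g y) @ x --> eps * g x.
    exact: (cvgM (cvg_cst eps) cg).
  have ceg' : (fun y => eps * g y) @ within K (nbhs x) --> eps * g x.
    exact: cvg_within_filter ceg.
  have cv : (fun y => (w y)^-1) @ x --> (w x)^-1 by exact: (cvgV wn0 cw).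
  have cv' : (fun y => (w y)^-1) @ within K (nbhs x) --> (w x)^-1.
    exact: cvg_within_filter cv.
  have cn := @cvgB _ _ _ _ FK _ _ _ _ cu' ceg'.
  exact: (@cvgM _ _ _ FK _ _ _ _ cn cv').
have {}cG : {within K, continuous G} by exact/subspace_continuousP.
have [z] := @EVT_max_rV R n.+1 G K (ex_intro _ x0 (inK x0 Ox0 Gx0))
  (@compact_cap Omega y0 M1) cG.
rewrite inE => Kz maxz.
have k0z : k0 < G z.
  have Kx0 : x0 \in K by rewrite inE; exact: (inK x0 Ox0 Gx0).
  exact: lt_le_trans Gx0 (maxz x0 Kx0).
have Oz := KO z Kz; have Hz := HO z Oz.
have {}maxz x : hclosure Omega x -> G x <= G z.
  move=> Ox; have [Gx|Gx] := lerP (G x) k0.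
    exact: le_trans Gx (ltW k0z).
  by apply: maxz; rewrite inE; exact: (inK x Ox Gx).
have uz : u z = G z * w z + eps * g z.
  by rewrite /G divfK ?lt0r_neq0 ?w0 // subrK.
have uz0 : 0 < u z.
  rewrite uz addr_gt0 // mulr_gt0 ?w0 ?g0 //.
  exact: lt_trans k0z.
have Omz : Omega z.
  apply: (@interior_subset _ Omega z); apply: contrapT => nOz.
  by move: uz0; rewrite (bdu z (conj Oz nOz)) ltxx.
pose k := G z.
(* [D] is u - k w - eps g, nested so that [hlaplacian_lin] applies. *)
pose D x := (- (2 * k)) * f x + ((k * c) * f' x + ((- eps) * g x + u x)).
have Dz : D z = 0 by rewrite /D uz /w -/k; ring.
have D0 x : Omega x -> D x <= D z.
  move=> Omx; have Ox : hclosure Omega x.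
    by split; [exact: OH | exact: subset_closure].
  have := maxz x Ox; rewrite {1}/G ler_pdivrMr ?w0 // Dz /D /w -/k; lra.
have tm a b : twice_partial Omega (monomial xi a b).
  by move=> i x Ox; apply: (twice_partial_monomial a b xi0); exact: OH.
have t1 := twice_partial_lin (- eps) oO (tm _ _ : twice_partial Omega g) tu.
have t2 := twice_partial_lin (k * c) oO (tm _ _ : twice_partial Omega f') t1.
have t3 := twice_partial_lin (- (2 * k)) oO (tm _ _ : twice_partial Omega f) t2.
have := hlaplacian_le0_at_max oO OH t3 Omz D0.
rewrite (hlaplacian_lin _ oO OH (tm _ _ : twice_partial Omega f) t2 Omz).
rewrite (hlaplacian_lin _ oO OH (tm _ _ : twice_partial Omega f') t1 Omz).
rewrite (hlaplacian_lin _ oO OH (tm _ _ : twice_partial Omega g) tu Omz).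
rewrite (hlaplacian_height_power _ _ xi0 Hz).
rewrite (hlaplacian_height_power _ _ xi0 Hz).
rewrite (hlaplacian_growing_barrier _ _ xi0 Hz) -/p -/(f z) -/(f' z) -/(g z).
have -> : hlaplacian u z = - (lambda * u z) by rewrite -(eigu z Omz) opprK.
(* The exponents s and s - 1: this is where s = n/2 is used. *)
have -> : s * (s - n%:R) = - lambda1 R n.+1.
  by rewrite /lambda1 -natr1 addrK /s; field.
have -> : (s - 1) * (s - 1 - n%:R) = 1 - lambda1 R n.+1.
  by rewrite /lambda1 -natr1 addrK /s; field.
have pz0 := p0 z Hz; have fz0 := f0 z Hz.
have [pY _] := Gcap z Oz k0z.
have hp3 : eps * (4 * (s + 1) * p z ^+ 3) < k * c.
  apply: le_lt_trans (lt_trans eps_Y _); last by rewrite ltr_pM2r.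
  rewrite ler_pM2l // ler_pM2l ?mulr_gt0 ?addr_gt0 //.
  by rewrite lerXn2r // nnegrE ltW.
have key : eps * (4 * (s + 1) * (p z ^+ 2 * f z)) < k * c * f' z.
  rewrite f'E // [ltRHS]mulrA ltr_pdivlMr //.
  have -> : eps * (4 * (s + 1) * (p z ^+ 2 * f z)) * p z
    = eps * (4 * (s + 1) * p z ^+ 3) * f z by ring.
  by rewrite ltr_pM2r.
have lamu : lambda * u z <= lambda1 R n.+1 * u z by rewrite ler_pM2r.
have uzE : u z = 2 * k * f z - k * c * f' z + eps * g z.
  by rewrite uz /w -/k; ring.
apply/negP; rewrite -ltNge.
have -> : - (2 * k) * (- lambda1 R n.+1 * f z) +
  (k * c * ((1 - lambda1 R n.+1) * f' z) +
   (- eps * (- lambda1 R n.+1 * g z + 4 * (s + 1) * (p z ^+ 2 * f z)) +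
    - (lambda * u z)))
  = (lambda1 R n.+1 * u z - lambda * u z) +
    (k * c * f' z - eps * (4 * (s + 1) * (p z ^+ 2 * f z))).
  by rewrite [in lambda1 R n.+1 * u z]uzE; ring.
by rewrite ltr_wpDl ?subr_ge0 ?subr_gt0.
Qed.

End phragmen_lindelof.

(** * Vanishing of bounded eigenfunctions *)

Section vanishing.
Context (R : realType) (n : nat).
Notation E := 'rV[R]_n.+1.
Implicit Types (x z xi : E) (inv : bool) (u : E -> R) (Omega : set E).

Lemma bounded_eigenfunction_eq0 inv xi (c lambda M : R) Omega u :
  (0 < n)%N -> height xi = 0 -> 0 < c -> lambda <= lambda1 R n.+1 ->
  open Omega -> Omega `<=` @hspace R n ->
  (forall x, hclosure Omega x -> c <= horoheight inv xi x) ->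
  eigenfunction lambda Omega u ->
  ~ (forall x, hclosure Omega x -> `|u x| <= M).
Proof.
move=> n0 xi0 c0 hlam oO OH hc [[cu C2u] [x Ox ux0] eigu bdu] uM.
have tu := C2_on_twice_partial C2u.
have u_le0 : u x <= 0.
  apply: (bounded_subsolution_le0 n0 xi0 c0 hlam oO OH hc cu tu eigu bdu _ Ox).
  by move=> z Oz; exact: le_trans (ler_norm _) (uM z Oz).
(* [v] is - u, in the form to which [twice_partial_lin] and [hlaplacian_lin]
   apply. *)
pose v z := -2 * u z + u z.
have vE z : v z = - u z by rewrite /v; ring.
have v_le0 : v x <= 0.
  apply: (@bounded_subsolution_le0 R n inv xi c lambda M Omega v
    n0 xi0 c0 hlam oO OH hc _ _ _ _ _ _ Ox).
  - move=> z; apply: cvgD; last exact: cu.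
    by apply: cvgM; [exact: cvg_cst | exact: cu].
  - exact: twice_partial_lin.
  - move=> z Oz.
    rewrite (hlaplacian_lin (-2) oO OH tu tu Oz) vE mulrN -eigu //.
    by ring.
  - by move=> z Oz; rewrite vE bdu // oppr0.
  - move=> z Oz; rewrite vE; apply: le_trans (uM z Oz).
    by rewrite -normrN ler_norm.
by move: ux0; rewrite eq_le u_le0 -oppr_le0 -vE v_le0.
Qed.

Lemma closure_ge0 Omega (g : E -> R) : continuous g ->
  (forall x, Omega x -> 0 <= g x) -> forall x, hclosure Omega x -> 0 <= g x.
Proof.
move=> cg h x [_ clx].
have := @closure_subset _ _ [set x | 0 <= g x] h x clx.
by rewrite -(closure_id _).1 //; exact: closed_ge0.
Qed.

End vanishing.

Theorem theorem3p8 (R : realType) (n : nat) (hn : (2 <= n.+1)%N)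
    (B Omega : set 'rV[R]_n.+1) (lambda : R)
    (hB : horoball B) (hOmega : open Omega) (hOmegaB : Omega `<=` B)
    (hunbounded : ~ hbounded Omega)
    (hlambda : 0 <= lambda <= lambda1 R n.+1) :
  ~ exists u : 'rV[R]_n.+1 -> R,
      eigenfunction lambda Omega u /\ [bounded u x | x in hclosure Omega].
Proof.
move=> [u [eigu [N [_ bdu]]]].
have uM x : hclosure Omega x -> `|u x| <= N + 1 by apply: bdu; rewrite ltrDl.
have [c rc BE] := hB.
have OB x : Omega x -> horoball_of c x by rewrite -BE; exact: hOmegaB.
have OH : Omega `<=` @hspace R n by move=> x /OB[].
have lam : lambda <= lambda1 R n.+1 by case/andP: hlambda.
have h0 : 0 < height (c 0) by case: rc => hc _; exact: hc.
have [[M hM]|unb] :=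
  pselect (exists M, \forall t \near +oo, sqdist 0 (c t) <= M).
- have [xi xi0 hxi] := horoball_bounded_ray rc hM.
  have d0 : 0 < sqdist xi (c 0) by exact: sqdist_gt0.
  apply: (@bounded_eigenfunction_eq0 R n true xi
    (height (c 0) / sqdist xi (c 0)) lambda (N + 1) Omega u) => //.
    by rewrite divr_gt0.
  move=> x Ox; have Hx : hspace x by case: Ox.
  rewrite /horoheight ler_pdivrMr // mulrAC ler_pdivlMr; last exact: sqdist_gt0.
  rewrite -subr_ge0.
  apply: (@closure_ge0 R n Omega (fun x => height x * sqdist xi (c 0)
    - height (c 0) * sqdist xi x)) Ox.
    move=> y.
    exact: (cvgB
      (cvgM (@continuous_height R n y) (cvg_cst (sqdist xi (c 0))))
      (cvgM (cvg_cst (height (c 0))) (@continuous_sqdist R n xi y))).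
  by move=> y /OB /hxi; rewrite subr_ge0.
- apply: (@bounded_eigenfunction_eq0 R n false 0 (height (c 0))
    lambda (N + 1) Omega u) => //.
    by rewrite /height mxE.
  move=> x Ox; rewrite /horoheight -subr_ge0.
  apply: (@closure_ge0 R n Omega (fun x => height x - height (c 0))) Ox.
    move=> y; exact: (cvgB (@continuous_height R n y) (cvg_cst (height (c 0)))).
  move=> y /OB; rewrite subr_ge0; apply: horoball_escaping_ray => // M hM.
  by apply: unb; exists M.
Qed.
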